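(* Let $\mathcal{M}$ be a matroid of rank $2$ on a ground set of order $m$. Then all roots of $\mathrm{Rel}(\mathcal{M};q)$ lie in the closed unit disk $\{z\in\mathbb{C}:|z|\le 1\}$.
   Context: A matroid on a nonempty finite set $X$ is a nonempty collection $\mathcal{M}$ of subsets of $X$ closed under taking subsets and satisfying the exchange axiom: if $\sigma,\alpha\in\mathcal{M}$ with $|\sigma|<|\alpha|$, there is $z\in\alpha\setminus\sigma$ with $\sigma\cup\{z\}\in\mathcal{M}$. Its rank is the largest cardinality of a member of $\mathcal{M}$. The reliability polynomial is $\mathrm{Rel}(\mathcal{M};q)=\sum_{\sigma\in\mathcal{M}} q^{|\sigma|}(1-q)^{|X\setminus\sigma|}$. *)

(* Defs.v *)
From HB Require Import structures.
From mathcomp Require Import all_boot all_order all_algebra.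

Set Implicit Arguments.
Unset Strict Implicit.
Unset Printing Implicit Defensive.

Import GRing.Theory.
Local Open Scope ring_scope.

Definition is_matroid (X : finType) (M : {set {set X}}) : Prop :=
  [/\ (0 < #|X|)%N,
      M != set0,
      forall s a : {set X}, a \in M -> s \subset a -> s \in M
    & forall s a : {set X}, s \in M -> a \in M -> (#|s| < #|a|)%N ->
        exists2 z, z \in a :\: s & z |: s \in M].

Definition matroid_rank (X : finType) (M : {set {set X}}) : nat :=
  (\max_(s in M) #|s|)%N.

Definition rel_poly (K : comNzRingType) (X : finType) (M : {set {set X}}) :
    {poly K} :=
  \sum_(s in M) 'X^#|s| * (1 - 'X) ^+ #|~: s|.

(* Main.v *)
Require Import Defs.
From HB Require Import structures.
From mathcomp Require Import all_boot all_order all_algebra.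
From mathcomp Require Import complex reals.
From mathcomp Require Import zify ring lra.

Set Implicit Arguments.
Unset Strict Implicit.
Unset Printing Implicit Defensive.

Import Order.TTheory GRing.Theory Num.Theory.
Local Open Scope ring_scope.

(** If [n] counts the non-loops and [e] the independent pairs, then
    [Rel(M;q) = (1-q)^(m-2) (1 + (n-2) q + (e-n+1) q^2)].  Parallelism is an
    equivalence relation on the non-loops, and a parallel class of size [c]
    gives [e >= c (n - c)], which is at least [2 n - 4] for [2 <= c <= n - 2];
    [c = n - 1] forces [e = n - 1], and if all classes are singletons then
    [e = n (n - 1) / 2].  Hence either [e = n - 1], and the second factor is
    affine, or [n - 2 <= (e - n + 1) + 1]; the latter places the real roots of
    the quadratic in [-1, 0], while nonreal roots [z] satisfy
    [(e - n + 1) |z|^2 = 1]. *)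

Definition nonloops (X : finType) (M : {set {set X}}) : {set X} :=
  [set x | [set x] \in M].

Definition indep_pairs (X : finType) (M : {set {set X}}) : {set {set X}} :=
  [set s in M | #|s| == 2%N].

(** For [y = x] the set [[set x; y]] collapses to a singleton, independent when [x] is a non-loop;
    hence the separate clause [y == x]. *)
Definition parallel_class (X : finType) (M : {set {set X}}) (x : X) : {set X} :=
  [set y in nonloops M | (y == x) || ([set x; y] \notin M)].

(** * Independent sets and the rank *)

Lemma set0_indep (X : finType) (M : {set {set X}}) :
  is_matroid M -> set0 \in M.
Proof.
by case=> _ /set0Pn[s sM] sub _; apply: sub sM (sub0set s).
Qed.

Lemma card_indep_le (X : finType) (M : {set {set X}}) (s : {set X}) :
  s \in M -> (#|s| <= matroid_rank M)%N.
Proof. by move=> sM; rewrite /matroid_rank (leq_bigmax_cond _ sM). Qed.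

Lemma exists_indep_of_rank (X : finType) (M : {set {set X}}) :
  is_matroid M -> exists2 s, s \in M & #|s| = matroid_rank M.
Proof.
move=> hM; have nM : (0 < #|M|)%N.
  by apply/card_gt0P; exists set0; apply: set0_indep.
have [s sM hs] := eq_bigmax_cond (fun s : {set X} => #|s|) nM.
by exists s.
Qed.

Lemma pair_nonloops (X : finType) (M : {set {set X}}) (x y : X) :
  is_matroid M -> [set x; y] \in M -> x \in nonloops M /\ y \in nonloops M.
Proof.
case=> _ _ sub _ xyM; split; rewrite inE; apply: sub xyM _;
by rewrite sub1set !inE eqxx ?orbT.
Qed.

(** Augmenting [[set y]] from [[set x; z]] adjoins [x] or [z]. Read contrapositively, this is
    transitivity of parallelism. *)
Lemma pair_exchange (X : finType) (M : {set {set X}}) (x y z : X) :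
  is_matroid M -> [set x; z] \in M -> x != z -> y \in nonloops M ->
  ([set x; y] \in M /\ x != y) \/ ([set y; z] \in M /\ y != z).
Proof.
case=> _ _ _ exch xzM nxz; rewrite inE => yM.
have [|w] := exch _ _ yM xzM; first by rewrite cards1 cards2 nxz.
rewrite !inE => /andP[nwy /orP[]] /eqP ew; subst w => wM; first by left.
by right; rewrite setUC eq_sym.
Qed.

Lemma parallel_class_cross (X : finType) (M : {set {set X}}) (x y z : X) :
  is_matroid M ->
  y \in parallel_class M x -> z \in nonloops M :\: parallel_class M x ->
  [set y; z] \in M /\ y != z.
Proof.
move=> hM; rewrite in_setD !(in_set (fun y => _ && _)).
case/andP=> yN hy /andP[+ zN]; rewrite zN /= negb_or negbK => /andP[nzx xzM].
case/orP: hy => [/eqP-> | nxy]; first by rewrite eq_sym.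
rewrite eq_sym in nzx.
by case: (pair_exchange hM xzM nzx yN) => // -[xyM _]; rewrite xyM in nxy.
Qed.

(** If [y] and [z] were independent, [pair_exchange] would make [x] independent of one of them. *)
Lemma parallel_class_inner (X : finType) (M : {set {set X}}) (x y z : X) :
  is_matroid M -> x \in nonloops M ->
  y \in parallel_class M x -> z \in parallel_class M x ->
  y != z -> [set y; z] \notin M.
Proof.
move=> hM xN; rewrite !(in_set (fun y => _ && _)).
case/andP=> yN hy /andP[zN hz] nyz; apply/negP => yzM.
case/orP: hy => [/eqP ey | nxy].
  by subst y; rewrite eq_sym (negPf nyz) yzM in hz.
case/orP: hz => [/eqP ez | nxz].
  by subst z; rewrite setUC yzM in nxy.
case: (pair_exchange hM yzM nyz xN) => -[h _].
  by rewrite setUC h in nxy.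
by rewrite h in nxz.
Qed.

Lemma parallel_class_sub (X : finType) (M : {set {set X}}) (x : X) :
  parallel_class M x \subset nonloops M.
Proof. by apply/subsetP=> y; rewrite in_set => /andP[]. Qed.

(** * Counting independent pairs *)

Lemma card_set2_image (X : finType) (A B : {set X}) : [disjoint A & B] ->
  #|[set [set p.1; p.2] | p in setX A B]| = (#|A| * #|B|)%N.
Proof.
move=> dAB; rewrite card_in_imset ?cardsX // => -[a b] [a' b'] /=.
rewrite !inE /= => /andP[aA bB] /andP[aA' bB'] /setP eqs.
(* Disjointness lets the ordered pair be recovered from the unordered one. *)
have dis x y : x \in A -> y \in B -> x == y = false.
  move=> xA yB; apply/eqP=> exy; subst y.
  by move/pred0P: dAB => /(_ x); rewrite /= xA yB.
have := eqs a; rewrite !inE eqxx (dis a b') // orbF => /esym/eqP ->.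
by have := eqs b; rewrite !inE eqxx orbT [b == _]eq_sym dis //= => /esym/eqP->.
Qed.

Lemma parallel_class_card_pairs (X : finType) (M : {set {set X}}) (x : X) :
  is_matroid M ->
  (#|parallel_class M x| * (#|nonloops M| - #|parallel_class M x|)
     <= #|indep_pairs M|)%N.
Proof.
move=> hM; set C := parallel_class M x.
have -> : (#|nonloops M| - #|C| = #|nonloops M :\: C|)%N.
  by rewrite cardsD (setIidPr (parallel_class_sub M x)).
rewrite -card_set2_image; last first.
  by rewrite -setI_eq0; apply/eqP/setP=> y;
     rewrite in_setI in_setD in_set0; case: (y \in C).
apply: subset_leq_card; apply/subsetP=> _ /imsetP[[y z] /= + ->].
rewrite in_setX /= => /andP[yC zD].
by have [yzM nyz] := parallel_class_cross hM yC zD; rewrite inE yzM cards2 nyz.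
Qed.

(** Two members of the class are never independent, so every independent pair contains [w] and is
    determined by its other element. *)
Lemma parallel_class_card_pairs_co1 (X : finType) (M : {set {set X}})
    (x w : X) :
  is_matroid M -> x \in nonloops M ->
  nonloops M :\: parallel_class M x = [set w] ->
  (#|indep_pairs M| <= #|parallel_class M x|)%N.
Proof.
move=> hM xN hw; set C := parallel_class M x.
apply: leq_trans (leq_imset_card (fun y => [set y; w]) C).
apply: subset_leq_card; apply/subsetP=> s.
rewrite inE => /andP[sM /cards2P[y [z [nyz es]]]]; subst s.
have [yN zN] := pair_nonloops hM sM.
have inCw u : u \in nonloops M -> u \in C \/ u = w.
  move=> uN; case: (boolP (u \in C)) => [|nu]; first by left.
  right; apply/eqP; rewrite -in_set1 -hw in_setD nu //.
have [yC|ey] := inCw _ yN; have [zC|ez] := inCw _ zN.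
- by have := parallel_class_inner hM xN yC zC nyz; rewrite sM.
- by rewrite ez; apply/imsetP; exists y.
- by rewrite ey setUC; apply/imsetP; exists z.
- by rewrite ey ez eqxx in nyz.
Qed.

Lemma rank2_card_bounds (X : finType) (M : {set {set X}}) :
  is_matroid M -> matroid_rank M = 2%N ->
  [/\ (2 <= #|nonloops M|)%N, (#|nonloops M| <= #|indep_pairs M| + 1)%N
    & (#|indep_pairs M| + 1 == #|nonloops M|) ||
      (2 * #|nonloops M| <= #|indep_pairs M| + 4)]%N.
Proof.
move=> hM hrk; set n := #|nonloops M|; set e := #|indep_pairs M|.
have [s sM] := exists_indep_of_rank hM.
rewrite hrk => /eqP/cards2P[u [v [nuv es]]]; subst s.
have [uN vN] := pair_nonloops hM sM.
have n2 : (2 <= n)%N.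
  have : ([set u; v] \subset nonloops M) by rewrite subUset !sub1set uN.
  by move/subset_leq_card; rewrite cards2 nuv.
have co x : x \in nonloops M -> (#|parallel_class M x| < n)%N.
  move=> xN; apply: proper_card; rewrite properE parallel_class_sub /=.
  apply/subsetPn.
  (* Exchanging [x] into the basis [[set u; v]] shows that [u] or [v] lies outside the class of
     [x]. *)
  case: (pair_exchange hM sM nuv xN) => -[h nh].
    by exists u => //; rewrite in_set negb_and uN negb_or nh negbK setUC.
  by exists v => //; rewrite in_set negb_and vN negb_or eq_sym nh negbK.
have pos x : x \in nonloops M -> (0 < #|parallel_class M x|)%N.
  by move=> xN; apply/card_gt0P; exists x; rewrite in_set xN eqxx.
have lower x := @parallel_class_card_pairs X M x hM.
(* For [1 <= c <= n - 1], [c (n - c) - (n - 1) = (c - 1) (n - c - 1) >= 0]. *)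
have base : (n <= e + 1)%N.
  have := lower u; have := co u uN; have := pos u uN.
  rewrite -/n -/e; move: #|parallel_class M u| => c; nia.
split=> //.
(* If all classes are singletons, every pair of non-loops is independent. *)
case: (boolP [exists x in nonloops M, 1 < #|parallel_class M x|]%N); last first.
  rewrite negb_exists_in => /forall_inP h1; apply/orP; right.
  have : ([set s : {set X} | s \subset nonloops M & #|s| == 2%N]
          \subset indep_pairs M).
    apply/subsetP=> s; rewrite !inE => /andP[sN s2]; rewrite s2 andbT.
    case/cards2P: s2 => x [y [nxy es]]; subst s.
    move: sN; rewrite subUset !sub1set => /andP[xN yN].
    apply: contraNT (h1 x xN) => nxyM.
    suff /subset_leq_card : [set x; y] \subset parallel_class M x.
      by rewrite cards2 nxy.
    by rewrite subUset !sub1set !(in_set (fun y => _ && _)) xN yN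
          eqxx nxyM orbT.
  move/subset_leq_card; rewrite cards_draws -/n -/e bin2 => h.
  (* The extra 1 absorbs the rounding of the halving in [bin2]. *)
  have : (n * n.-1 <= 2 * e + 1)%N by lia.
  case: n n2 {h base co lower} => [|[|k]] //= _; nia.
case/exists_inP=> x xN c2; have := lower x; have := co x xN; rewrite -/n -/e.
case: (leqP n (#|parallel_class M x| + 1)) => hc cn hl; last first.
  (* Here [2 <= c <= n - 2], and [c (n - c) - (2 n - 4) = (c - 2) (n - c - 2) >= 0]. *)
  apply/orP; right; move: c2 hl hc; move: #|parallel_class M x| => c; nia.
(* Now [c = n - 1], so [e <= c], and [base] forces equality. *)
have : #|nonloops M :\: parallel_class M x| = 1%N.
  by rewrite cardsD (setIidPr (parallel_class_sub M x)); lia.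
move/eqP/cards1P=> [w hw]; have := parallel_class_card_pairs_co1 hM xN hw.
by rewrite -/e => he; apply/orP; left; lia.
Qed.

(** * Closed form of the reliability polynomial *)

Lemma sum_rank2 (K : comNzRingType) (X : finType) (M : {set {set X}})
    (F : nat -> K) : is_matroid M -> matroid_rank M = 2%N ->
  \sum_(s in M) F #|s| =
    F 0 + F 1 *+ #|nonloops M| + F 2 *+ #|indep_pairs M|.
Proof.
move=> hM hrk.
rewrite (bigID (fun s : {set X} => #|s| == 2%N)) /= addrC; congr (_ + _).
  rewrite (bigID (fun s : {set X} => #|s| == 1%N)) /= addrC; congr (_ + _).
    rewrite (big_pred1 set0) ?cards0 // => s /=.
    apply/idP/eqP => [|->]; last by rewrite set0_indep ?cards0.
    case/andP=> /andP[sM s2] s1; have := card_indep_le sM.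
    by rewrite hrk => hs; apply/eqP; rewrite -cards_eq0; lia.
  rewrite (eq_bigr (fun=> F 1%N)) => [|s /andP[_ /eqP->]//].
  rewrite sumr_const; congr (_ *+ _).
  rewrite -(card_imset (mem (nonloops M)) (@set1_inj X)).
  apply: eq_card => s; rewrite unfold_in.
  apply/idP/imsetP => [/andP[/andP[sM _]] /cards1P[x es]|[x xN ->]].
    by exists x => //; rewrite inE -es.
  by move: xN; rewrite inE cards1 => ->.
rewrite (eq_bigr (fun=> F 2%N)) => [|s /andP[_ /eqP->]//].
by rewrite sumr_const; congr (_ *+ _); apply: eq_card => s; rewrite inE.
Qed.

(** All independent sets have size at most 2, so [(1 - z) ^+ (#|X| - 2)] factors out, leaving
    [(1 - z)^2 + n z (1 - z) + e z^2]. The bounds [2 <= n <= e + 1] make the truncated subtractions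
    exact. *)
Lemma rel_poly_rank2_horner (K : comNzRingType) (X : finType)
    (M : {set {set X}}) (z : K) : is_matroid M -> matroid_rank M = 2%N ->
  (rel_poly K M).[z] = (1 - z) ^+ (#|X| - 2) *
    (1 + (#|nonloops M| - 2)%:R * z
       + (#|indep_pairs M| + 1 - #|nonloops M|)%:R * z ^+ 2).
Proof.
move=> hM hrk; have [n2 ne _] := rank2_card_bounds hM hrk.
have m2 : (2 <= #|X|)%N by apply: leq_trans n2 (max_card _).
rewrite /rel_poly horner_sum.
rewrite (eq_bigr (fun s : {set X} => z ^+ #|s| * (1 - z) ^+ (#|X| - #|s|)));
  last by move=> s _; rewrite !hornerE [#|~: s|]cardsCs setCK.
rewrite (sum_rank2 (fun k => z ^+ k * (1 - z) ^+ (#|X| - k)) hM hrk).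
move: m2 n2 ne; case: #|X| => [|[|m]] // _.
move: #|nonloops M| #|indep_pairs M| => n e n2 ne.
rewrite !subSS !subn0 !natrB // natrD.
rewrite -[X in _ + X + _]mulr_natr -[X in _ + X = _]mulr_natr.
by rewrite !exprS !expr0; ring.
Qed.

(** * Location of the roots of the quadratic factor *)

Lemma quadratic_root_norm_le1 (R : realType) (a b : nat) (z : R[i]) :
  (a == 0)%N || (b <= a.+1)%N ->
  1 + b%:R * z + a%:R * z ^+ 2 = 0 -> `|z| <= 1.
Proof.
case: z => x y hab hz.
have ea : (a%:R : R[i]) = (a%:R)%:C%C by rewrite rmorph_nat.
have eb : (b%:R : R[i]) = (b%:R)%:C%C by rewrite rmorph_nat.
move: hz; rewrite ea eb expr2.
have hab' : a%:R = 0 :> R \/ (1 <= a%:R :> R /\ b%:R <= a%:R + 1 :> R).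
  case: (posnP a) hab => [-> _|ap]; first by left.
  move=> hb; right; split; first by rewrite ler1n.
  by rewrite natr1 ler_nat.
(* Integrality of [b] puts the root [-1/b] of the affine case in the disk. *)
have hb1 : b%:R = 0 :> R \/ 1 <= b%:R :> R.
  by case: (posnP b) => [->|bp]; [left|right; rewrite ler1n].
move: (a%:R) (b%:R) hab' hb1 => {ea eb hab}a' b' hab hb [].
rewrite !mul0r !subr0 !addr0 !add0r => hre him.
rewrite normc_def lecR -[leRHS]sqrtr1; apply: ler_wsqrtr => /=.
have [a0 | [a1 ba]] := hab.
  move: hre him; rewrite a0 !mul0r !addr0 => hre him.
  have [b0 | b1] := hb; first by move: hre; rewrite b0; lra.
  have y0 : y = 0.
    by move/eqP: him; rewrite mulf_eq0 => /orP[]/eqP //; lra.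
  have x0 : x <= 0 by nra.
  have x1 : -1 <= x by nra.
  rewrite y0; nra.
have [y0 | y0] := eqVneq y 0.
  have b0 : 0 <= b' by case: hb => [->|]; lra.
  have x0 : x <= 0 by rewrite y0 in hre; nra.
  have x1 : -1 <= x.
    rewrite leNgt; apply/negP => x1; rewrite y0 in hre.
    (* With [t = -x > 1], [b' <= a' + 1] gives [1 - b' t + a' t^2 >= (a' t - 1) (t - 1) > 0], so [x]
       is no root. *)
    have : 0 < (a' * - x - 1) * (- x - 1) by apply: mulr_gt0; nra.
    nra.
  rewrite y0; nra.
(* The imaginary part of the equation is [y (b' + 2 a' x)]; eliminating [b'] from the real part then
   yields [a' |z|^2 = 1]. *)
have hx : b' + 2 * a' * x = 0.
  apply: (mulIf y0); rewrite mul0r -him; ring.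
have : a' * (x ^+ 2 + y ^+ 2) = 1.
  have eb : b' = - (2 * a' * x) by lra.
  by move: hre; rewrite eb; lra.
have := sqr_ge0 x; have := sqr_ge0 y; nra.
Qed.

Theorem theorem4 (R : realType) (X : finType) (M : {set {set X}}) (m : nat)
    (hM : is_matroid M) (hrk : matroid_rank M = 2%N) (hm : #|X| = m) :
  forall z : complex R, root (rel_poly (complex R) M) z -> `|z| <= 1.
Proof.
move=> z; rewrite /root rel_poly_rank2_horner // mulf_eq0 => /orP[|/eqP].
  by rewrite expf_eq0 subr_eq0 => /andP[_ /eqP<-]; rewrite normr1.
apply: quadratic_root_norm_le1.
(* With [a = e + 1 - n] and [b = n - 2], the alternatives [e + 1 = n] and [2 n <= e + 4] become
   [a = 0] and [b <= a + 1]. *)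
by have [n2 ne ] := rank2_card_bounds hM hrk; lia.
Qed.
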